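(* Let $R$ be a commutative ring with non-zero identity and $I$ an ideal of $R$. Suppose that $I$ is maximal (with respect to inclusion) among the ideals $L$ of $R$ having the following property: $L$ is a weakly $J$-ideal of $R$ and $(0:a)$ is a weakly $J$-ideal of $R$ for all $a\in R\setminus L$. Then $I$ is a weakly prime ideal of $R$.
   Context: $J(R)$ denotes the Jacobson radical of $R$ and $(0:a)=\{x\in R: ax=0\}$. A proper ideal $I$ of $R$ is a weakly $J$-ideal if whenever $a,b\in R$ with $0\neq ab\in I$ and $a\notin J(R)$, then $b\in I$. A proper ideal $P$ of $R$ is weakly prime if whenever $a,b\in R$ with $0\neq ab\in P$, then $a\in P$ or $b\in P$. *)

(* Defs.v *)
From mathcomp Require Import all_boot all_order all_algebra.
From mathcomp Require Import boolp classical_sets.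

Set Implicit Arguments.
Unset Strict Implicit.
Unset Printing Implicit Defensive.

Import GRing.Theory.

Local Open Scope classical_set_scope.
Local Open Scope ring_scope.

Section IdealNotions.

Variable R : comNzRingType.
Implicit Types (I L M P : set R) (a : R).

(* The ideals of R are the submodules of the regular module R^o, on which *)
(* the scaling a *: x is a * x. The improper ideal R is included.         *)
Definition is_ideal I : Prop := submod_closed (mem I : {pred R^o}).

Definition is_proper_ideal I : Prop := is_ideal I /\ I <> [set: R].

Definition maximal_among (Q : set R -> Prop) I : Prop :=
  Q I /\ forall L, Q L -> I `<=` L -> L = I.

Definition is_maximal_ideal M : Prop := maximal_among is_proper_ideal M.

Definition jacobson_radical : set R :=
  \bigcap_(M in [set M | is_maximal_ideal M]) M.

Definition annihilator a : set R := [set x | a * x = 0].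

Definition weakly_J_ideal I : Prop :=
  is_proper_ideal I /\
  forall a b : R,
    a * b != 0 -> a * b \in I -> a \notin jacobson_radical -> b \in I.

Definition weakly_prime_ideal P : Prop :=
  is_proper_ideal P /\
  forall a b : R, a * b != 0 -> a * b \in P -> a \in P \/ b \in P.

End IdealNotions.

(* mathcomp's own closure predicate for (right) ideals has properness built *)
(* in; on sets it agrees with is_proper_ideal.                              *)
Lemma is_proper_idealP (R : comNzRingType) (I : set R) :
  is_proper_ideal I <-> idealr_closed (mem I).
Proof.
split=> [[[I0 Ilin] IneT]|[I0 I1 Ilin]]; split=> //.
  apply/negP => I1; apply: IneT; apply/seteqP; split=> // x _.
  by have := Ilin x 1 0 I1 I0; rewrite addr0 /GRing.scale /= mulr1 => /set_mem.
by move=> IT; move/negP: I1; apply; apply/mem_set; rewrite IT.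
Qed.

(* Main.v *)
Require Import Defs.
From mathcomp Require Import all_boot all_order all_algebra.
From mathcomp Require Import boolp classical_sets.

(** For a outside I, the colon ideal (I : a) contains I and inherits the
    property for which I is maximal: if x y is a nonzero element of (I : a) and
    x is not in J(R), then either a x y <> 0, and I being a weakly J-ideal gives
    a y in I, or x y lies in the weakly J-ideal (0 : a), whence a y = 0.
    So (I : a) = I, which says that a b in I forces b in I. *)

Import GRing.Theory.

Local Open Scope classical_set_scope.
Local Open Scope ring_scope.

Definition colon {R : comNzRingType} (I : set R) (a : R) : set R :=
  [set x | I (a * x)].

Lemma idealM {R : comNzRingType} (I : set R) (a x : R) :
  is_ideal I -> I x -> I (a * x).
Proof.
move=> [I0 Ilin] Ix.
have /set_mem := Ilin a x 0 (mem_set Ix) I0.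
by rewrite addr0.
Qed.

Lemma sub_colon {R : comNzRingType} (I : set R) (a : R) :
  is_ideal I -> I `<=` colon I a.
Proof. by move=> idI x; apply: idealM. Qed.

Lemma colon_ideal {R : comNzRingType} (I : set R) (a : R) :
  is_ideal I -> is_ideal (colon I a).
Proof.
move=> [I0 Ilin]; split=> [|c x y /set_mem Ix /set_mem Iy]; apply/mem_set.
  by rewrite /colon /= mulr0; apply: set_mem.
have /set_mem := Ilin c (a * x) (a * y) (mem_set Ix) (mem_set Iy).
by rewrite /colon /= /GRing.scale /= mulrDr (mulrCA a).
Qed.

(** If 1 were in [colon I a], then a = a * 1 would be in [I]. *)
Lemma colon_proper {R : comNzRingType} (I : set R) (a : R) :
  is_ideal I -> ~ I a -> is_proper_ideal (colon I a).
Proof.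
move=> idI nIa; split; first exact: colon_ideal.
move=> IaT; have : colon I a 1 by rewrite IaT.
by rewrite /colon /= mulr1.
Qed.

Lemma colon_weakly_J {R : comNzRingType} (I : set R) (a : R) :
  weakly_J_ideal I -> weakly_J_ideal (annihilator a) -> ~ I a ->
  weakly_J_ideal (colon I a).
Proof.
move=> [[idI _] wI] [_ wA] nIa; split; first exact: colon_proper.
move=> x y xy0 /set_mem Iaxy xJ; apply/mem_set; rewrite /colon /=.
have [axy0|axy0] := eqVneq (a * (x * y)) 0.
  have /set_mem : y \in annihilator a by apply: wA xy0 _ xJ; apply/mem_set.
  by rewrite /annihilator /= => ->; apply: set_mem; case: idI.
(* The product is regrouped as x * (a * y): the factor outside the Jacobson radical is still x, so
   [wI] puts a * y in [I]. *)
by apply/set_mem/(wI x) => //; rewrite mulrCA // mem_set.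
Qed.

Theorem corollary2 (R : comNzRingType) (I : set R) (hI : is_ideal I)
  (Imax : maximal_among
            (fun L : set R =>
               [/\ is_ideal L, weakly_J_ideal L &
                   forall a : R, a \notin L -> weakly_J_ideal (annihilator a)])
            I) :
  weakly_prime_ideal I.
Proof.
have [[_ wI wA] maxI] := Imax.
split=> [|a b _ /set_mem Iab]; first by case: wI.
have [Ia|nIa] := boolP (a \in I); [by left | right].
(* Replacing [I] by [colon I a] turns the goal on b into [Iab]. *)
suff <- : colon I a = I by apply/mem_set.
apply: maxI (sub_colon I a hI); split; first exact: colon_ideal.
  by apply: colon_weakly_J wI (wA a nIa) _; move/negP: nIa; apply: contra_not => /mem_set.
(* The annihilator condition passes to the larger ideal: an element outside [colon I a] is also
   outside [I]. *)
move=> c /negP nIc; apply: wA; apply/negP => /set_mem Ic.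
by apply/nIc/mem_set/(sub_colon I a hI).
Qed.
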